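(* Disjunction $\vee$ is not strongly definable in $\mathtt{NI}^2_{at}$; that is, it is not the case that for all $A,B\in\mathcal L^\vee$ there is a formula $C\in\mathcal L^2$ such that $C\dashv\vdash_{\mathtt{NI}^{2\vee}_{at}}A\vee B$.
   Context: Formulas, with $X$ ranging over propositional variables: $\mathcal L^2$: $A::=X\mid A\supset B\mid\forall X.A$; $\mathcal L^\vee$: $A::=X\mid A\supset B\mid A\vee B$; $\mathcal L^{2\vee}$: $A::=X\mid A\supset B\mid A\vee B\mid\forall X.A$. $\mathtt{NI}^{2\vee}_{at}$ is the natural deduction system over $\mathcal L^{2\vee}$ with the standard intuitionistic introduction and elimination rules for $\supset$ and $\vee$, the rule $\forall$I (from $A$ infer $\forall X.A$, provided $X$ is not free in the undischarged assumptions), and the atomic elimination rule $\forall$E$_{at}$: from $\forall X.A$ infer $A\llbracket Y/X\rrbracket$, where $Y$ must be a propositional variable. $\mathtt{NI}^2_{at}$ is its restriction to $\mathcal L^2$ (atomic System F). $A\dashv\vdash_{\mathtt{NI}^{2\vee}_{at}}B$ means that each of $A,B$ is derivable from the other in $\mathtt{NI}^{2\vee}_{at}$. Disjunction is called strongly definable in $\mathtt{NI}^2_{at}$ iff for all $A,B\in\mathcal L^\vee$ there is an $\mathcal L^2$-formula $C$ such that $C\dashv\vdash_{\mathtt{NI}^{2\vee}_{at}}A\vee B$. *)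

(* Defs.v *)
From Stdlib Require Import List.
Import ListNotations.

(* Formulas of L^{2v} modulo alpha-equivalence, with de Bruijn indices: [All A]
   is "forall X. A" where the bound X is index 0 of A and every index [S n] of A
   is the variable n outside the quantifier.  The propositional variables are
   thus the natural numbers. *)
Inductive form : Type :=
| Var (n : nat)
| Imp (A B : form)
| Or  (A B : form)
| All (A : form).

Fixpoint in_L2 (A : form) : Prop :=
  match A with
  | Var _ => True
  | Imp A B => in_L2 A /\ in_L2 B
  | Or _ _ => False
  | All A => in_L2 A
  end.

Fixpoint in_Lvee (A : form) : Prop :=
  match A with
  | Var _ => True
  | Imp A B => in_Lvee A /\ in_Lvee B
  | Or A B => in_Lvee A /\ in_Lvee B
  | All _ => False
  end.

Definition up (r : nat -> nat) (n : nat) : nat :=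
  match n with 0 => 0 | S m => S (r m) end.

(* Capture-avoiding substitution of variables for variables. *)
Fixpoint rename (r : nat -> nat) (A : form) : form :=
  match A with
  | Var n => Var (r n)
  | Imp A B => Imp (rename r A) (rename r B)
  | Or A B => Or (rename r A) (rename r B)
  | All A => All (rename (up r) A)
  end.

Definition shift : form -> form := rename S.

(* For [All A] = "forall X. A", [inst Y A] is A[Y/X]. *)
Definition inst (Y : nat) : form -> form :=
  rename (fun n => match n with 0 => Y | S m => m end).

(* [NI2v_at G A]: A has a natural deduction derivation whose undischarged
   assumptions all belong to G.  Membership in G, rather than position, lets a
   rule discharge any number of occurrences of an assumption, including none. *)
Inductive NI2v_at : list form -> form -> Prop :=
| Ax G A : In A G -> NI2v_at G A
| ImpI G A B : NI2v_at (A :: G) B -> NI2v_at G (Imp A B)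
| ImpE G A B : NI2v_at G (Imp A B) -> NI2v_at G A -> NI2v_at G B
| OrI1 G A B : NI2v_at G A -> NI2v_at G (Or A B)
| OrI2 G A B : NI2v_at G B -> NI2v_at G (Or A B)
| OrE G A B C :
    NI2v_at G (Or A B) -> NI2v_at (A :: G) C -> NI2v_at (B :: G) C ->
    NI2v_at G C
(* Shifting G makes index 0, the variable about to be bound, not free in it. *)
| AllI G A : NI2v_at (map shift G) A -> NI2v_at G (All A)
| AllE_at G A (Y : nat) : NI2v_at G (All A) -> NI2v_at G (inst Y A).

Definition interderivable (A B : form) : Prop :=
  NI2v_at [A] B /\ NI2v_at [B] A.

Definition or_strongly_definable : Prop :=
  forall A B : form, in_Lvee A -> in_Lvee B ->
  exists C : form, in_L2 C /\ interderivable C (Or A B).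

(* Main.v *)
From Stdlib Require Import List.
Require Import Defs.
Import ListNotations.

(** Because only variables instantiate a quantifier, [NI2v_at] is sound for Kripke
    models in which quantifiers range over one fixed set of propositions, not
    necessarily closed under the connectives ([soundness]).  Take the model with a
    root and two incomparable worlds above it, and let the quantifiers range over
    two propositions only, each true at exactly one of the upper worlds and false
    elsewhere.  Each of these has at the root the meet of its
    values at the two upper worlds, and implication and universal quantification
    preserve this property ([root_force]).  Hence a formula of L^2 that holds at
    both upper worlds holds at the root.  The disjunction of the two propositions
    holds at both upper worlds but not at the root, so no formula of L^2 is
    interderivable with it. *)

(** Worlds: [None] is the root, [Some true] and [Some false] are the worlds above. *)
Definition world : Type := option bool.

Definition le (w v : world) : Prop := w = None \/ w = v.

(** Forcing.  A Boolean [b] names the proposition that holds exactly at the world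
    [Some b]; an environment [e] assigns such a name to every variable. *)
Fixpoint force (w : world) (e : nat -> bool) (A : form) : Prop :=
  match A with
  | Var n => w = Some (e n)
  | Imp A B => forall v, le w v -> force v e A -> force v e B
  | Or A B => force w e A \/ force w e B
  | All A =>
      forall b, force w (fun n => match n with 0 => b | S m => e m end) A
  end.

Lemma le_refl w : le w w.
Proof. now right. Qed.

Lemma le_trans u v w : le u v -> le v w -> le u w.
Proof.
  intros [-> | ->] H; [now left | exact H].
Qed.

Lemma force_mono A : forall w v e, le w v -> force w e A -> force v e A.
Proof.
  induction A as [n | A IHA B IHB | A IHA B IHB | A IHA];
    simpl; intros w v e Hwv H.
  - destruct Hwv as [-> | <-]; [discriminate | exact H].
  - intros u Hu. apply H. now apply le_trans with v.
  - destruct H as [H | H]; [left | right]; eauto.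
  - intros b. eauto.
Qed.

(** The environments are related pointwise rather than by an equation between
    functions, so that the induction passes under quantifiers without functional
    extensionality. *)
Lemma force_rename A : forall w r e e',
  (forall n, e (r n) = e' n) -> (force w e (rename r A) <-> force w e' A).
Proof.
  induction A as [n | A IHA B IHB | A IHA B IHB | A IHA];
    simpl; intros w r e e' He.
  - now rewrite He.
  - split; intros H v Hv HA; apply (IHB v r e e' He), H; trivial;
      now apply (IHA v r e e' He).
  - now rewrite (IHA w r e e' He), (IHB w r e e' He).
  - split; intros H b; eapply IHA; try apply (H b); now intros [|n]; simpl.
Qed.

Lemma soundness G A : NI2v_at G A ->
  forall w e, (forall B, In B G -> force w e B) -> force w e A.
Proof.
  induction 1 as
    [ G A HA | G A B _ IH | G A B _ IH1 _ IH2 | G A B _ IH | G A B _ IH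
    | G A B C _ IH _ IHA _ IHB | G A _ IH | G A Y _ IH ]; intros w e HG.
  - now apply HG.
  - intros v Hv HA. apply IH. intros D [<- | HD]; [exact HA |].
    apply force_mono with w; auto.
  - exact (IH1 w e HG w (le_refl w) (IH2 w e HG)).
  - left. auto.
  - right. auto.
  - destruct (IH w e HG) as [H | H]; [apply IHA | apply IHB];
      intros D [<- | HD]; auto.
  - intros b. apply IH. intros D HD.
    apply in_map_iff in HD as [D' [<- HD']].
    apply (force_rename D' w S _ e); [reflexivity | auto].
  - apply (force_rename A w _ e
             (fun n => match n with 0 => e Y | S m => e m end)).
    + now intros [|n].
    + exact (IH w e HG (e Y)).
Qed.

(** This fails for disjunction, whose value at the root may lie strictly below the
    meet of its values at the upper worlds. *)
Lemma root_force A : in_L2 A ->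
  forall e, (forall b, force (Some b) e A) -> force None e A.
Proof.
  induction A as [n | A IHA B IHB | A IHA B IHB | A IHA];
    simpl; intros HL e H.
  - discriminate (eq_trans (H true) (eq_sym (H false))).
  - destruct HL as [_ HB]. intros [b |] _ HA.
    + exact (H b (Some b) (le_refl _) HA).
    + apply (IHB HB). intros b. apply (H b _ (le_refl _)).
      apply force_mono with None; [now left | exact HA].
  - contradiction.
  - intros b. apply (IHA HL). intros c. apply H.
Qed.

Theorem proposition8 : ~ or_strongly_definable.
Proof.
  intros Hdef.
  destruct (Hdef (Var 0) (Var 1) I I) as [C [HC [HCor HorC]]].
  set (e := fun n => match n with 0 => true | S _ => false end).
  assert (Hroot : force None e C).
  { apply (root_force C HC). intros b. apply (soundness _ _ HorC).
    intros D [<- | []]. destruct b; [left | right]; reflexivity. }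
  assert (Hor : force None e (Or (Var 0) (Var 1))).
  { apply (soundness _ _ HCor). now intros D [<- | []]. }
  destruct Hor as [H | H]; discriminate H.
Qed.
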